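(* Let $q,a,b$ be nonzero complex numbers with $|q|<1$ and $\max\{|ab|,|aq^2|,|bq^2|\}<1$. Then $$\frac{(q^2,ab;q^2)_\infty}{(aq^2,bq^2;q^2)_\infty}\;{}_3\phi_2\left(\begin{matrix}q^2/a,\,q^2/b,\,q\\ -q^2,\,q^3\end{matrix};q^2,-ab\right)=(1-q)\sum_{n=0}^\infty\sum_{j=-n}^n(-1)^n(1+q^{2n+1})\frac{(q^2/a,q^2/b;q^2)_n}{(aq^2,bq^2;q^2)_n}(ab)^nq^{n^2-j^2}.$$
   Context: Notation, for a base $p$ with $|p|<1$: $(x;p)_0=1$, $(x;p)_n=\prod_{k=0}^{n-1}(1-xp^k)$, $(x;p)_\infty=\prod_{k=0}^\infty(1-xp^k)$, $(x_1,\dots,x_k;p)_n=(x_1;p)_n\cdots(x_k;p)_n$ (also for $n=\infty$), and $${}_3\phi_2\left(\begin{matrix}A_1,A_2,A_3\\ B_1,B_2\end{matrix};p,z\right)=\sum_{n=0}^\infty\frac{(A_1,A_2,A_3;p)_n}{(p,B_1,B_2;p)_n}z^n .$$ *)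

(* Defs.v *)
From Stdlib Require Import Reals ZArith.
From Coquelicot Require Import Coquelicot.

Open Scope R_scope.
Open Scope C_scope.

(* [CLim] and [CSeries] are total, like Coquelicot's [Lim_seq] and [Series]:
   they are the limit, resp. the sum, only when it exists, and carry no
   information otherwise. *)
Definition CLim (u : nat -> C) : C :=
  iota (fun l : C_CompleteNormedModule => filterlim u eventually (locally l)).

Definition CSeries (u : nat -> C) : C :=
  iota (fun l : C_CompleteNormedModule => is_series u l).

(* (x; p)_n *)
Fixpoint qpoch (x p : C) (n : nat) : C :=
  match n with
  | O => 1
  | S m => qpoch x p m * (1 - x * p ^ m)
  end.

(* (x; p)_oo *)
Definition qpoch_inf (x p : C) : C := CLim (qpoch x p).

Definition phi32_term (A1 A2 A3 B1 B2 p z : C) (n : nat) : C :=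
  (qpoch A1 p n * qpoch A2 p n * qpoch A3 p n)
  / (qpoch p p n * qpoch B1 p n * qpoch B2 p n) * z ^ n.

Definition phi32 (A1 A2 A3 B1 B2 p z : C) : C :=
  CSeries (phi32_term A1 A2 A3 B1 B2 p z).

(* The sum of [f j] over the integers -n <= j <= n, indexed by k = j + n. *)
Definition sum_sym (f : Z -> C) (n : nat) : C :=
  sum_n (fun k : nat => f (Z.of_nat k - Z.of_nat n)%Z) (2 * n).

(* In the exponent n^2 - j^2, [Z.to_nat] does not truncate, as |j| <= n. *)
Definition double_sum_term (q a b : C) (n : nat) : C :=
  sum_sym
    (fun j : Z =>
       (-1) ^ n * (1 + q ^ (2 * n + 1))
       * ((qpoch (q ^ 2 / a) (q ^ 2) n * qpoch (q ^ 2 / b) (q ^ 2) n)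
          / (qpoch (a * q ^ 2) (q ^ 2) n * qpoch (b * q ^ 2) (q ^ 2) n))
       * (a * b) ^ n
       * q ^ Z.to_nat (Z.of_nat n * Z.of_nat n - j * j))
    n.

(* Main.v *)
(* In base [p = q^2], put [beta n = (-1)^n (1 - q) / ((1 - q^(2n+1)) (p^2;p^2)_n)] and
   [alpha r = (-1)^r (1 - q) (1 + q^(2r+1)) / (1 - p) * sum_(|j| <= r) q^(r^2 - j^2)].
   These form a Bailey pair relative to [p]: summation by parts turns
   [sum_r alpha r / ((p;p)_(n-r) (p^2;p)_(n+r))] into Gauss's alternating sum of
   q-binomial coefficients.  The finite Bailey lemma with [rho1 = p/a], [rho2 = p/b]
   (that is, q-Pfaff-Saalschutz summed against [alpha]) then yields a terminating
   version of the identity, and Tannery's theorem lets its order [N] tend to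
   infinity. *)

Require Import Defs.
From Stdlib Require Import Reals ZArith Lra Lia.
From Coquelicot Require Import Coquelicot.

Open Scope R_scope.
Open Scope C_scope.

(** * Finite sums, and elementary facts on complex powers and moduli *)

Notation Csum := (@sum_n C_AbelianMonoid).

Lemma Csum_0 (f : nat -> C) : Csum f 0 = f O.
Proof. exact (sum_O f). Qed.

Lemma Csum_S (f : nat -> C) (n : nat) :
  Csum f (S n) = Csum f n + f (S n).
Proof. exact (sum_Sn f n). Qed.

Lemma Csum_ext (f g : nat -> C) (n : nat) :
  (forall k, (k <= n)%nat -> f k = g k) -> Csum f n = Csum g n.
Proof. exact (sum_n_ext_loc f g n). Qed.

Lemma Csum_scal (c : C) (f : nat -> C) (n : nat) :
  Csum (fun k => c * f k) n = c * Csum f n.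
Proof. exact (sum_n_mult_l (K := C_Ring) c f n). Qed.

(** Both sides run over the triangle [r <= j <= N], with [j = r + k] on the right. In the induction
    the new row [j = N + 1] adds one term to each inner sum and opens the sum for [r = N + 1]. *)
Lemma Csum_triangle (f : nat -> nat -> C) (N : nat) :
  Csum (fun j => Csum (f j) j) N
  = Csum (fun r => Csum (fun k => f (r + k)%nat r) (N - r)) N.
Proof.
  induction N as [|N IH].
  - now rewrite !Csum_0.
  - rewrite !Csum_S, IH, Nat.sub_diag, Csum_0, Nat.add_0_r.
    rewrite Cplus_assoc; f_equal.
    rewrite <- (sum_n_plus (G := C_AbelianMonoid)).
    apply Csum_ext; intros r Hr.
    rewrite (Nat.sub_succ_l r N Hr), Csum_S.
    now replace (r + S (N - r))%nat with (S N) by lia.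
Qed.

Lemma Cmult_cancel_l (c x y : C) : c <> 0 -> c * x = c * y -> x = y.
Proof.
  intros Hc H.
  rewrite <- (Cmult_1_l x), <- (Cmult_1_l y), <- (Cinv_l c Hc).
  now rewrite <- !Cmult_assoc, H.
Qed.

Lemma Cpow_odd (q : C) (n : nat) : q ^ (2 * n + 1) = q * (q ^ 2) ^ n.
Proof. rewrite Cpow_add_r, Cpow_mult_r, Cpow_1_r; apply Cmult_comm. Qed.

Lemma Cone_minus_neq0 (x : C) : (Cmod x < 1)%R -> 1 - x <> 0.
Proof.
  intros Hx H.
  assert (E : x = 1) by (rewrite <- (Cplus_0_l x), <- H; ring).
  rewrite E, Cmod_1 in Hx; lra.
Qed.

Lemma Cmod_pow_lt_1 (x : C) (n : nat) :
  (Cmod x < 1)%R -> (Cmod (x ^ S n) < 1)%R.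
Proof.
  intros Hx; rewrite Cmod_pow.
  apply pow_lt_1_compat; [split; [apply Cmod_ge_0 | exact Hx] | lia].
Qed.

Lemma Cmod_mult_pow_le (x p : C) (n : nat) :
  (Cmod p < 1)%R -> (Cmod (x * p ^ n) <= Cmod x)%R.
Proof.
  intros Hp; rewrite Cmod_mult, Cmod_pow.
  rewrite <- (Rmult_1_r (Cmod x)) at 2.
  apply Rmult_le_compat_l; [apply Cmod_ge_0|].
  rewrite <- (pow1 n).
  apply pow_incr; split; [apply Cmod_ge_0 | lra].
Qed.

(** * Finite q-Pochhammer symbols and the q-Pfaff-Saalschutz sum *)

Lemma qpoch_S (x p : C) (n : nat) :
  qpoch x p (S n) = qpoch x p n * (1 - x * p ^ n).
Proof. reflexivity. Qed.

Lemma qpoch_neq0 (x p : C) (n : nat) :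
  (Cmod x < 1)%R -> (Cmod p < 1)%R -> qpoch x p n <> 0.
Proof.
  intros Hx Hp; induction n as [|n IH]; simpl.
  - exact C1_nz.
  - apply Cmult_neq_0; [exact IH|].
    apply Cone_minus_neq0.
    now apply Rle_lt_trans with (Cmod x); [apply Cmod_mult_pow_le|].
Qed.

Lemma qpoch_add (x p : C) (m n : nat) :
  qpoch x p (m + n) = qpoch x p m * qpoch (x * p ^ m) p n.
Proof.
  induction n as [|n IH].
  - rewrite Nat.add_0_r; simpl; ring.
  - rewrite Nat.add_succ_r; simpl; rewrite IH, Cpow_add_r; ring.
Qed.

(** Both sides equal [(x;p)_(n+1)]. This later relates [(p;p)_(n+1)] to [(p^2;p)_n], and [(q;q^2)_n]
    to [(q^3;q^2)_n]. *)
Lemma qpoch_shift (x p : C) (n : nat) :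
  (1 - x) * qpoch (x * p) p n = qpoch x p n * (1 - x * p ^ n).
Proof.
  induction n as [|n IH]; simpl; [ring|].
  rewrite Cmult_assoc, IH; ring.
Qed.

(** The factors pair up as [(1 - p^(k+1)) (1 + p^(k+1)) = 1 - p^(2k+2)]. This merges two
    denominators of the 3phi2 into the one of [beta]. *)
Lemma qpoch_opp (p : C) (n : nat) :
  qpoch p p n * qpoch (- p) p n = qpoch (p ^ 2) (p ^ 2) n.
Proof.
  induction n as [|n IH]; [simpl; ring|].
  rewrite !qpoch_S, <- IH, <- Cpow_mult_r, Nat.mul_comm, Cpow_mult_r; ring.
Qed.

(* q-Pfaff-Saalschutz.  With [T M k] the summand and [C = A * B * z],
   [(1 - p^(M+1)) (1 - C p^M) T (M+1) k - (1 - A z p^M) (1 - B z p^M) T M k]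
   telescopes in [k]; its partial sums are the right-hand side of [Htel]. *)
Lemma q_saalschutz (A B z p : C) (M : nat) :
  (forall n, qpoch p p n <> 0) -> (forall n, qpoch (A * B * z) p n <> 0) ->
  Csum (fun k => qpoch A p k * qpoch B p k * z ^ k
                    / (qpoch p p k * qpoch (A * B * z) p k)
                  * (qpoch z p (M - k) / qpoch p p (M - k))) M
  = qpoch (A * z) p M * qpoch (B * z) p M
    / (qpoch p p M * qpoch (A * B * z) p M).
Proof.
  intros Hp HC.
  set (c := A * B * z) in *.
  assert (Fp : forall n, 1 - p * p ^ n <> 0).
  { intros n H; apply (Hp (S n)); simpl; rewrite H; ring. }
  assert (Fc : forall n, 1 - c * p ^ n <> 0).
  { intros n H; apply (HC (S n)); simpl; rewrite H; ring. }
  set (T := fun M k => qpoch A p k * qpoch B p k * z ^ k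
                    / (qpoch p p k * qpoch c p k)
                  * (qpoch z p (M - k) / qpoch p p (M - k))).
  change (Csum (T M) M = qpoch (A * z) p M * qpoch (B * z) p M
    / (qpoch p p M * qpoch c p M)).
  assert (Htel : forall M j, (j <= M)%nat ->
    (1 - p * p ^ M) * (1 - c * p ^ M) * Csum (T (S M)) j
    - (1 - A * z * p ^ M) * (1 - B * z * p ^ M) * Csum (T M) j
    = - (p ^ (M - j) * (qpoch A p (S j) * qpoch B p (S j) * z ^ S j
                          / (qpoch p p j * qpoch c p j)
         * (qpoch z p (M - j) / qpoch p p (M - j))))).
  { clear M; intros M j; induction j as [|j IH]; intros Hj.
    - rewrite !Csum_0; unfold T; rewrite !Nat.sub_0_r; simpl.
      unfold c in *; field; cbv beta; auto.
    - rewrite !Csum_S.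
      assert (Hj' : (j <= M)%nat) by lia.
      specialize (IH Hj').
      transitivity
       ((1 - p * p ^ M) * (1 - c * p ^ M) * Csum (T (S M)) j
        - (1 - A * z * p ^ M) * (1 - B * z * p ^ M) * Csum (T M) j
        + ((1 - p * p ^ M) * (1 - c * p ^ M) * T (S M) (S j)
        - (1 - A * z * p ^ M) * (1 - B * z * p ^ M) * T M (S j))); [ring|].
      rewrite IH; unfold T; clear IH.
      (* Writing [M = d + (j + 1)] removes truncated subtraction: every power and symbol reduces to
         index [d] or [j], and a rational identity in independent variables remains. *)
      destruct (Nat.le_exists_sub (S j) M Hj) as [d [-> _]].
      replace (d + S j - j)%nat with (S d) by lia.
      replace (S (d + S j) - S j)%nat with (S d) by lia.
      replace (d + S j - S j)%nat with d by lia.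
      rewrite Cpow_add_r; simpl.
      generalize (Hp d) (Hp j) (HC j) (Fp d) (Fp j) (Fc j).
      generalize (p ^ d) (p ^ j) (qpoch p p d) (qpoch p p j) (qpoch c p j)
        (qpoch A p j) (qpoch B p j) (qpoch z p d) (z ^ j).
      intros; unfold c in *; field; cbv beta; repeat split; auto. }
  induction M as [|M IH].
  - rewrite Csum_0; unfold T; simpl; field; exact C1_nz.
  - rewrite Csum_S.
    (* At [j = M], [Htel] omits only the term [k = M + 1] of the sum of order [M + 1]; that term is
       added back below. *)
    specialize (Htel M M (le_n M)); rewrite IH in Htel.
    rewrite Nat.sub_diag in Htel.
    assert (E : (1 - p * p ^ M) * (1 - c * p ^ M) <> 0)
      by (apply Cmult_neq_0; auto).
    apply Cmult_cancel_l with (1 := E).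
    match type of Htel with ?l - ?r = _ => match goal with
      |- ?e * (?s + ?t) = _ => transitivity ((l - r) + (r + e * t)); [ring|]
    end end.
    rewrite Htel; unfold T; rewrite Nat.sub_diag; simpl.
    field; cbv beta; repeat split; auto.
Qed.

(** * The finite Bailey lemma *)

(** In the usual notation the pair is relative to [rho1 * rho2 * z / p]; taking [z] as the parameter
    avoids the division. Once the sums are interchanged, the inner sum for each [r] is
    q-Pfaff-Saalschutz with [rho1 p^r], [rho2 p^r] and the same [z]. *)
Lemma finite_bailey_lemma (alpha beta : nat -> C) (rho1 rho2 z p : C) (N : nat) :
  (forall n, qpoch p p n <> 0) ->
  (forall n, qpoch (rho1 * rho2 * z) p n <> 0) ->
  (forall n, qpoch (rho1 * z) p n <> 0) ->
  (forall n, qpoch (rho2 * z) p n <> 0) ->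
  (forall n, beta n
     = Csum (fun r => alpha r / (qpoch p p (n - r)
                                 * qpoch (rho1 * rho2 * z) p (n + r))) n) ->
  Csum (fun j => qpoch rho1 p j * qpoch rho2 p j * z ^ j * beta j
                 * (qpoch z p (N - j) / qpoch p p (N - j))) N
  = qpoch (rho1 * z) p N * qpoch (rho2 * z) p N
    * Csum (fun r => qpoch rho1 p r * qpoch rho2 p r
                     / (qpoch (rho1 * z) p r * qpoch (rho2 * z) p r)
                     * z ^ r * alpha r
                     / (qpoch p p (N - r)
                        * qpoch (rho1 * rho2 * z) p (N + r))) N.
Proof.
  intros Hp Hc H1 H2 Hbeta.
  set (c := rho1 * rho2 * z) in *.
  transitivity (Csum (fun j => Csum (fun r =>
     qpoch rho1 p j * qpoch rho2 p j * z ^ j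
     * (qpoch z p (N - j) / qpoch p p (N - j))
     * (alpha r / (qpoch p p (j - r) * qpoch c p (j + r)))) j) N).
  { apply Csum_ext; intros j _; rewrite Csum_scal, <- Hbeta; ring. }
  rewrite (Csum_triangle (fun j r =>
     qpoch rho1 p j * qpoch rho2 p j * z ^ j
     * (qpoch z p (N - j) / qpoch p p (N - j))
     * (alpha r / (qpoch p p (j - r) * qpoch c p (j + r))))).
  rewrite <- Csum_scal.
  apply Csum_ext; intros r Hr.
  destruct (Nat.le_exists_sub r N Hr) as [M [-> _]].
  replace (M + r - r)%nat with M by lia.
  set (A := rho1 * p ^ r); set (B := rho2 * p ^ r).
  assert (E : A * B * z = c * p ^ (r + r))
    by (unfold A, B, c; rewrite Cpow_add_r; ring).
  (* [(A B z;p)_n] is the tail of [(c;p)_(2r+n)], hence nonzero. *)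
  assert (HE : forall n, qpoch (A * B * z) p n <> 0).
  { intros n Hn; apply (Hc (r + r + n)%nat).
    rewrite qpoch_add, <- E, Hn; ring. }
  transitivity (qpoch rho1 p r * qpoch rho2 p r * z ^ r * alpha r
                / qpoch c p (r + r)
     * Csum (fun k => qpoch A p k * qpoch B p k * z ^ k
                    / (qpoch p p k * qpoch (A * B * z) p k)
                  * (qpoch z p (M - k) / qpoch p p (M - k))) M).
  - rewrite <- Csum_scal; apply Csum_ext; intros k Hk.
    replace (M + r - (r + k))%nat with (M - k)%nat by lia.
    replace (r + k - r)%nat with k by lia.
    replace (r + k + r)%nat with (r + r + k)%nat by lia.
    rewrite (qpoch_add rho1), (qpoch_add rho2), (qpoch_add c p (r + r) k).
    rewrite Cpow_add_r, <- E.
    fold A B; field; auto.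
  - rewrite (q_saalschutz A B z p M Hp HE).
    replace (M + r)%nat with (r + M)%nat by lia.
    replace (r + M + r)%nat with (r + r + M)%nat by lia.
    (* The closed form supplies the tails that complete [(rho1 z;p)_r] and [(rho2 z;p)_r] to order
       [N = r + M], and [(c;p)_(2r)] to order [N + r]. *)
    rewrite (qpoch_add (rho1 * z)), (qpoch_add (rho2 * z)), (qpoch_add c p (r + r) M).
    rewrite <- E.
    replace (rho1 * z * p ^ r) with (A * z) by (unfold A; ring).
    replace (rho2 * z * p ^ r) with (B * z) by (unfold B; ring).
    field; auto 6.
Qed.

(** * The Bailey pair *)

Lemma qpoch_1_minus_neq0 (x p : C) :
  (forall n, qpoch x p n <> 0) -> forall n, 1 - x * p ^ n <> 0.
Proof. intros H n E; apply (H (S n)); rewrite qpoch_S, E; ring. Qed.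

(* Gauss's alternating sum of q-binomial coefficients of order [2n],
   folded by the symmetry [r -> -r]. *)
Lemma gauss_alternating_sum (p : C) (n : nat) :
  (forall n, qpoch p p n <> 0) -> (forall n, qpoch (p ^ 2) (p ^ 2) n <> 0) ->
  2 * Csum (fun r => (-1) ^ r / (qpoch p p (n - r) * qpoch p p (n + r))) n
  - 1 / (qpoch p p n * qpoch p p n)
  = (-1) ^ n / qpoch (p ^ 2) (p ^ 2) n.
Proof.
  intros Hp Hp2.
  pose proof (qpoch_1_minus_neq0 p p Hp) as Fp.
  pose proof (qpoch_1_minus_neq0 _ _ Hp2) as Fp2.
  set (W := fun n r => (-1) ^ r / (qpoch p p (n - r) * qpoch p p (n + r))).
  (* If [F R] denotes the first summand on the right, the right-hand side is [F R - F (-1)]. *)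
  assert (Htel : forall n R, (R <= n)%nat ->
    (1 - p ^ 2 * (p ^ 2) ^ n) * Csum (W (S n)) R + Csum (W n) R
    = (-1) ^ R / (qpoch p p (n - R) * qpoch p p (n + S R))
      + 1 / (qpoch p p (S n) * qpoch p p n)).
  { clear n; intros n R; induction R as [|R IH]; intros HR.
    - rewrite !Csum_0; unfold W.
      rewrite !Nat.sub_0_r, Nat.add_1_r, !Nat.add_0_r, !qpoch_S.
      (* Turns [(p ^ 2) ^ n] into [(p ^ n) ^ 2], so that [field] sees the single atom [p ^ n]. *)
      rewrite <- Cpow_mult_r, Nat.mul_comm, Cpow_mult_r.
      simpl; field; cbv beta; auto.
    - rewrite !Csum_S.
      specialize (IH (Nat.le_trans _ _ _ (Nat.le_succ_diag_r R) HR)).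
      match type of IH with ?l = _ => match goal with
       |- _ * (_ + ?s) + (_ + ?t) = _ =>
         transitivity (l + ((1 - p ^ 2 * (p ^ 2) ^ n) * s + t)); [ring|]
      end end.
      rewrite IH; unfold W; clear IH.
      destruct (Nat.le_exists_sub (S R) n HR) as [d [-> _]].
      replace (d + S R - R)%nat with (S d) by lia.
      replace (S (d + S R) - S R)%nat with (S d) by lia.
      replace (d + S R - S R)%nat with d by lia.
      replace (S (d + S R) + S R)%nat with (S (S (d + R + S R))) by lia.
      replace (d + S R + S (S R))%nat with (S (S (d + R + S R))) by lia.
      replace (d + S R + S R)%nat with (S (d + R + S R)) by lia.
      pose proof (Fp (S (d + R + S R))).
      pose proof (Fp (d + R + S R)%nat).
      rewrite !qpoch_S in *.
      rewrite <- Cpow_mult_r, Nat.mul_comm, Cpow_mult_r.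
      generalize (Hp (d + R + S R)%nat) (Hp d) (Hp (d + S R)%nat) (Fp d)
        (Fp (d + S R)%nat).
      generalize (qpoch p p (d + R + S R)) (qpoch p p (d + S R)) (qpoch p p d).
      intros; generalize dependent p.
      intros p; rewrite !(Cpow_S p), !Cpow_add_r, !(Cpow_S p), !(Cpow_S (-1)); intros.
      field; cbv beta; repeat split; auto. }
  (* This is the recurrence of [(-1)^n / (p^2;p^2)_n]. As [Htel] at [R = n] stops short of
     [r = n + 1], the last term is added separately. *)
  assert (Hrec : forall n, (1 - p ^ 2 * (p ^ 2) ^ n)
    * (2 * Csum (W (S n)) (S n) - 1 / (qpoch p p (S n) * qpoch p p (S n)))
    = - (2 * Csum (W n) n - 1 / (qpoch p p n * qpoch p p n))).
  { clear n; intros n; specialize (Htel n n (le_n n)).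
    rewrite Csum_S.
    apply Ceq_minus.
    match type of Htel with ?l = _ =>
      transitivity (2 * l
        + 2 * (1 - p ^ 2 * (p ^ 2) ^ n) * W (S n) (S n)
        - (1 - p ^ 2 * (p ^ 2) ^ n) * (1 / (qpoch p p (S n) * qpoch p p (S n)))
        - 1 / (qpoch p p n * qpoch p p n)); [ring|]
    end.
    rewrite Htel; clear Htel.
    unfold W; rewrite !Nat.sub_diag.
    replace (S n + S n)%nat with (S (n + S n)) by lia.
    rewrite (qpoch_S p p (n + S n)).
    rewrite <- Cpow_mult_r, Nat.mul_comm, Cpow_mult_r.
    pose proof (Fp (n + S n)%nat) as F1; pose proof (Hp (n + S n)%nat) as F2.
    revert F1 F2; generalize (qpoch p p (n + S n)).
    rewrite Cpow_add_r; simpl; intros.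
    field; cbv beta; repeat split; auto. }
  induction n as [|n IH].
  - rewrite Csum_0; unfold W; simpl; field; exact C1_nz.
  - apply Cmult_cancel_l with (1 := Fp2 n).
    rewrite Hrec.
    change (Csum _ n) with (Csum (W n) n) in IH.
    rewrite IH, qpoch_S, (Cpow_S (-1)).
    generalize (Hp2 n) (Fp2 n).
    generalize (1 - p ^ 2 * (p ^ 2) ^ n) ((-1) ^ n) (qpoch (p ^ 2) (p ^ 2) n).
    intros; field; auto.
Qed.

(* [theta r] is the sum of [q^(r^2 - j^2)] over [-r <= j <= r]. *)
Fixpoint theta (q : C) (r : nat) : C :=
  match r with
  | O => 1
  | S r' => q ^ (2 * r' + 1) * theta q r' + 2
  end.

(* With [G r = (-1)^r q^(r^2) / ((p;p)_(n-r) (p;p)_(n+r))] and [p = q^2], the factor of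
   [theta q r] is [q^(- r^2) (G r - G (r+1)) / (1 - q^(2n+1))], so summation by parts
   reduces the sum to Gauss's. *)
Lemma theta_bailey_pair (q : C) (n : nat) :
  (forall m, qpoch (q ^ 2) (q ^ 2) m <> 0) ->
  (forall m, qpoch ((q ^ 2) ^ 2) ((q ^ 2) ^ 2) m <> 0) ->
  (1 - q ^ (2 * n + 1))
  * Csum (fun r => (-1) ^ r * (1 + q ^ (2 * r + 1)) * theta q r
                   / (qpoch (q ^ 2) (q ^ 2) (n - r)
                      * qpoch (q ^ 2) (q ^ 2) (n + r + 1))) n
  = (-1) ^ n / qpoch ((q ^ 2) ^ 2) ((q ^ 2) ^ 2) n.
Proof.
  intros Hp Hp2; rewrite <- (gauss_alternating_sum _ n Hp Hp2).
  set (p := q ^ 2) in *.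
  pose proof (qpoch_1_minus_neq0 p p Hp) as Fp.
  set (W := fun r => (-1) ^ r / (qpoch p p (n - r) * qpoch p p (n + r))).
  assert (Hodd : forall m, q ^ (2 * m + 1) = q * p ^ m) by apply Cpow_odd.
  set (c := fun r => (-1) ^ r * (1 + q ^ (2 * r + 1)) * theta q r
                   / (qpoch p p (n - r) * qpoch p p (n + r + 1))).
  (* [Csum c R - c R] is the sum over [r < R], and [W R * theta q R] is the boundary term. The [+ 2]
     in the recurrence of [theta] produces the doubled sum; the start [theta q 0 = 1] accounts for
     the subtracted central term. *)
  assert (Hparts : forall R, (R <= n)%nat ->
    (1 - q * p ^ n) * (Csum c R - c R) + W R * theta q R
    = 2 * Csum W R - 1 / (qpoch p p n * qpoch p p n)).
  { intros R; induction R as [|R IH]; intros HR.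
    - rewrite !Csum_0; unfold W; rewrite Nat.sub_0_r, Nat.add_0_r; simpl.
      field; auto.
    - rewrite !Csum_S.
      specialize (IH (Nat.le_trans _ _ _ (Nat.le_succ_diag_r R) HR)).
      apply Ceq_minus.
      match type of IH with ?l = ?r => apply Ceq_minus in IH;
        transitivity ((l - r) + ((1 - q * p ^ n) * c R - W R * theta q R
         + W (S R) * (theta q (S R) - 2))); [ring|]
      end.
      rewrite IH, Cplus_0_l; clear IH; unfold W, c.
      destruct (Nat.le_exists_sub (S R) n HR) as [d [-> _]].
      replace (d + S R - R)%nat with (S d) by lia.
      replace (d + S R - S R)%nat with d by lia.
      replace (d + S R + R + 1)%nat with (S (d + S R + R)) by lia.
      replace (d + S R + S R)%nat with (S (d + S R + R)) by lia.
      change (theta q (S R)) with (q ^ (2 * R + 1) * theta q R + 2).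
      rewrite !Hodd, !qpoch_S.
      generalize (Hp d) (Hp (d + S R + R)%nat) (Fp d) (Fp (d + S R + R)%nat).
      generalize (qpoch p p d) (qpoch p p (d + S R + R)).
      rewrite !Cpow_add_r, (Cpow_S (-1)), (Cpow_S p).
      (* The identity depends on [p = q^2], so [field] must see [p] as [q * q], while the powers
         with variable exponent stay atoms. *)
      assert (Ep : p = q * q) by (unfold p; ring).
      rewrite Ep.
      generalize ((-1) ^ R) ((q * q) ^ R) ((q * q) ^ d).
      intros; field; cbv beta; repeat split; auto. }
  specialize (Hparts n (le_n n)).
  change (Csum _ n) with (Csum W n) at 2.
  rewrite <- Hparts, Hodd.
  apply Ceq_minus.
  (* The boundary term is exactly the missing term [r = n]: [(1 - q^(2n+1)) (1 + q^(2n+1)) = 1 -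
     p^(2n+1)] cancels the last factor of [(p;p)_(2n+1)]. *)
  transitivity ((1 - q * p ^ n) * c n - W n * theta q n); [ring|].
  unfold c, W; rewrite Nat.sub_diag, Hodd, Nat.add_1_r, qpoch_S.
  generalize (Hp (n + n)%nat) (Fp (n + n)%nat).
  generalize (qpoch p p (n + n)).
  rewrite Cpow_add_r.
  assert (Ep : p = q * q) by (unfold p; ring).
  rewrite Ep; simpl.
  generalize ((-1) ^ n) ((q * q) ^ n).
  intros; field; cbv beta; repeat split; auto.
Qed.

(** * Evaluation and bound of the inner sum over [j] *)

Lemma Csum_split_first (f : nat -> C) (n : nat) :
  Csum f (S n) = f O + Csum (fun k => f (S k)) n.
Proof.
  induction n as [|n IH].
  - now rewrite Csum_S, !Csum_0.
  - now rewrite Csum_S, IH, (Csum_S (fun k => f (S k))), Cplus_assoc.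
Qed.

(** From [n] to [n + 1], the new ends [j = -(n+1)] and [j = n + 1] have exponent 0 and contribute 2;
    every other exponent grows by [(n+1)^2 - n^2 = 2n + 1]. *)
Lemma theta_sum_sym (q : C) (n : nat) :
  sum_sym (fun j => q ^ Z.to_nat (Z.of_nat n * Z.of_nat n - j * j)) n
  = theta q n.
Proof.
  unfold sum_sym; induction n as [|n IH]; [now rewrite Csum_0|].
  change (theta q (S n)) with (q ^ (2 * n + 1) * theta q n + 2).
  rewrite <- IH; clear IH.
  replace (2 * S n)%nat with (S (S (2 * n))) by lia.
  rewrite Csum_S, Csum_split_first, <- Csum_scal.
  rewrite (Csum_ext _ (fun k => q ^ (2 * n + 1) *
    q ^ Z.to_nat (Z.of_nat n * Z.of_nat n
       - (Z.of_nat k - Z.of_nat n) * (Z.of_nat k - Z.of_nat n)))).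
  - replace (Z.to_nat _) with O by nia.
    match goal with |- context [q ^ Z.to_nat ?z] =>
      replace (Z.to_nat z) with O by nia end.
    simpl; ring.
  - intros k Hk; rewrite <- Cpow_add_r; f_equal; nia.
Qed.

Lemma double_sum_term_theta (q a b : C) (n : nat) :
  double_sum_term q a b n
  = (-1) ^ n * (1 + q ^ (2 * n + 1))
    * ((qpoch (q ^ 2 / a) (q ^ 2) n * qpoch (q ^ 2 / b) (q ^ 2) n)
       / (qpoch (a * q ^ 2) (q ^ 2) n * qpoch (b * q ^ 2) (q ^ 2) n))
    * (a * b) ^ n * theta q n.
Proof.
  unfold double_sum_term; rewrite <- theta_sum_sym.
  unfold sum_sym; exact (Csum_scal _ _ _).
Qed.

(** The bound is the fixed point of [t -> |q| t + 2], a map that dominates the recurrence of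
    [theta]. *)
Lemma theta_bound (q : C) (n : nat) :
  (Cmod q < 1)%R -> (Cmod (theta q n) <= 2 / (1 - Cmod q))%R.
Proof.
  intros Hq; pose proof (Cmod_ge_0 q) as Hq0.
  assert (H1 : (0 < 1 - Cmod q)%R) by lra.
  induction n as [|n IH].
  - simpl; rewrite Cmod_1.
    apply Rmult_le_reg_r with (1 := H1); field_simplify; lra.
  - change (theta q (S n)) with (q ^ (2 * n + 1) * theta q n + 2).
    eapply Rle_trans; [apply Cmod_triangle|].
    rewrite Cmod_mult, Cmod_R, Rabs_pos_eq by lra.
    assert (Hp : (Cmod (q ^ (2 * n + 1)) <= Cmod q)%R).
    { rewrite Nat.add_1_r, Cpow_S; now apply Cmod_mult_pow_le. }
    assert (Hm : (Cmod (q ^ (2 * n + 1)) * Cmod (theta q n)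
                  <= Cmod q * (2 / (1 - Cmod q)))%R).
    { apply Rmult_le_compat; auto using Cmod_ge_0. }
    assert (E : (Cmod q * (2 / (1 - Cmod q)) + 2 = 2 / (1 - Cmod q))%R)
      by (field; lra).
    lra.
Qed.

(** * Uniform bounds on q-Pochhammer symbols *)

Lemma exp_monotone (x y : R) : (x <= y)%R -> (exp x <= exp y)%R.
Proof.
  intros [H| ->]; [left; now apply exp_increasing | right; reflexivity].
Qed.

(** Each factor is at most [exp (|x| |p|^k)]. The induction keeps the partial geometric sum in the
    exponent, which never exceeds [s]. *)
Lemma qpoch_bounded (x p : C) :
  (Cmod p < 1)%R -> exists K, forall n, (Cmod (qpoch x p n) <= K)%R.
Proof.
  intros Hp; pose proof (Cmod_ge_0 p) as Hp0; pose proof (Cmod_ge_0 x) as Hx0.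
  set (s := (Cmod x / (1 - Cmod p))%R).
  assert (Hs : (0 <= s)%R) by (apply Rdiv_le_0_compat; lra).
  assert (H : forall n, (Cmod (qpoch x p n) <= exp (s * (1 - Cmod p ^ n)))%R).
  { intros n; induction n as [|n IH].
    - simpl; rewrite Cmod_1, Rminus_diag, Rmult_0_r, exp_0; lra.
    - rewrite qpoch_S, Cmod_mult.
      replace (s * (1 - Cmod p ^ S n))%R
        with (s * (1 - Cmod p ^ n) + Cmod x * Cmod p ^ n)%R
        by (unfold s; simpl; field; lra).
      rewrite exp_plus.
      apply Rmult_le_compat; auto using Cmod_ge_0.
      eapply Rle_trans; [apply Cmod_triangle|].
      rewrite Cmod_1, Cmod_opp, Cmod_mult, Cmod_pow.
      apply exp_ineq1_le. }
  exists (exp s); intros n; eapply Rle_trans; [apply H|].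
  apply exp_monotone.
  pose proof (pow_le (Cmod p) n Hp0); nra.
Qed.

Lemma qpoch_bounded_below (x p : C) :
  (Cmod x < 1)%R -> (Cmod p < 1)%R ->
  exists d, (0 < d)%R /\ forall n, (d <= Cmod (qpoch x p n))%R.
Proof.
  intros Hx Hp; pose proof (Cmod_ge_0 p) as Hp0; pose proof (Cmod_ge_0 x) as Hx0.
  (* [u] is chosen so that [(1 - |x|) (1 + u) = 1]. Then [1 - |x| t >= 1 / (1 + u t) >= exp (- u t)]
     for [0 <= t <= 1], and the exponents form a geometric sum bounded by [s]. *)
  set (u := (Cmod x / (1 - Cmod x))%R).
  assert (Hu : (0 <= u)%R) by (apply Rdiv_le_0_compat; lra).
  set (s := (u / (1 - Cmod p))%R).
  assert (Hs : (0 <= s)%R) by (apply Rdiv_le_0_compat; lra).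
  assert (H : forall n, (exp (- (s * (1 - Cmod p ^ n))) <= Cmod (qpoch x p n))%R).
  { intros n; induction n as [|n IH].
    - simpl; rewrite Cmod_1, Rminus_diag, Rmult_0_r, Ropp_0, exp_0; lra.
    - rewrite qpoch_S, Cmod_mult.
      set (t := (Cmod p ^ n)%R) in *.
      assert (Ht : (0 <= t <= 1)%R).
      { split; [now apply pow_le|]; unfold t; rewrite <- (pow1 n).
        apply pow_incr; lra. }
      replace (- (s * (1 - Cmod p ^ S n)))%R
        with (- (s * (1 - t)) + - (u * t))%R
        by (unfold s, t; simpl; field; lra).
      rewrite exp_plus.
      apply Rmult_le_compat; auto using Rlt_le, exp_pos.
      assert (H1 : (1 - Cmod x * t <= Cmod (1 - x * p ^ n))%R).
      { pose proof (Cmod_triangle (1 - x * p ^ n) (x * p ^ n)) as H1.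
        replace (1 - x * p ^ n + x * p ^ n) with (RtoC 1) in H1 by ring.
        rewrite Cmod_1, Cmod_mult, Cmod_pow in H1; fold t in H1; lra. }
      apply Rle_trans with (2 := H1).
      rewrite exp_Ropp.
      assert (H2 : (1 <= (1 - Cmod x * t) * (1 + u * t))%R).
      { replace ((1 - Cmod x * t) * (1 + u * t))%R
          with (1 + t * Cmod x * (u * (1 - t)))%R
          by (unfold u; field; lra).
        assert (0 <= t * Cmod x * (u * (1 - t)))%R; [|lra].
        apply Rmult_le_pos; apply Rmult_le_pos; lra. }
      pose proof (exp_ineq1_le (u * t)) as H3.
      apply Rmult_le_reg_r with (1 := exp_pos (u * t)).
      rewrite Rinv_l by (apply Rgt_not_eq, exp_pos).
      apply Rle_trans with (1 := H2).
      apply Rmult_le_compat_l; [nra | exact H3]. }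
  exists (exp (- s)); split; [apply exp_pos|].
  intros n; eapply Rle_trans; [|apply H].
  apply exp_monotone.
  pose proof (pow_le (Cmod p) n Hp0); nra.
Qed.

(** * Limits of complex sequences and infinite products *)

(** Convergence is phrased through real distances so that limit theorems for real sequences apply;
    [Ccvg_filterlim] links it to the filters behind [CLim] and [is_series]. *)
Definition Ccvg (u : nat -> C) (l : C) : Prop :=
  is_lim_seq (fun n => Cmod (u n - l)) 0%R.

Lemma Ccvg_filterlim (u : nat -> C) (l : C) :
  Ccvg u l
  <-> filterlim u eventually (locally (T := C_CompleteNormedModule) l).
Proof.
  split; intros H.
  - intros P HP.
    destruct (locally_norm_le_locally (V := C_NormedModule) l P HP) as [eps HP'].
    apply is_lim_seq_spec in H; destruct (H eps) as [N HN].
    exists N; intros n Hn; apply HP'; specialize (HN n Hn).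
    rewrite Rminus_0_r, Rabs_pos_eq in HN by apply Cmod_ge_0; exact HN.
  - apply is_lim_seq_spec; intros eps.
    destruct (H (fun v => Cmod (v - l) < eps)%R) as [N HN].
    + apply (locally_le_locally_norm (V := C_NormedModule) l).
      exists eps; intros y Hy; exact Hy.
    + exists N; intros n Hn.
      rewrite Rminus_0_r, Rabs_pos_eq by apply Cmod_ge_0; now apply HN.
Qed.

Lemma Ccvg_CLim (u : nat -> C) (l : C) : Ccvg u l -> CLim u = l.
Proof.
  intros H; apply Ccvg_filterlim in H; unfold CLim.
  exact (iota_filterlim_locally u l H).
Qed.

Lemma is_series_CSeries (u : nat -> C) (l : C) :
  is_series (V := C_NormedModule) u l -> CSeries u = l.
Proof.
  intros H; unfold CSeries, is_series.
  exact (iota_filterlim_locally (V := C_CompleteNormedModule) (sum_n u) l H).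
Qed.

Lemma Ccvg_unique (u : nat -> C) (l m : C) : Ccvg u l -> Ccvg u m -> l = m.
Proof.
  intros Hl Hm; apply Ccvg_CLim in Hl; apply Ccvg_CLim in Hm; congruence.
Qed.

Lemma Ccvg_squeeze (u : nat -> C) (l : C) (v : nat -> R) :
  (forall n, (Cmod (u n - l) <= v n)%R) -> is_lim_seq v 0%R -> Ccvg u l.
Proof.
  intros H Hv; apply is_lim_seq_le_le with (u := fun _ => 0%R) (w := v); auto.
  - split; [apply Cmod_ge_0 | apply H].
  - apply is_lim_seq_const.
Qed.

Lemma Ccvg_Cmod (u : nat -> C) (l : C) :
  Ccvg u l -> is_lim_seq (fun n => Cmod (u n)) (Cmod l).
Proof.
  intros H; apply is_lim_seq_le_le with
    (u := fun n => (Cmod l - Cmod (u n - l))%R)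
    (w := fun n => (Cmod l + Cmod (u n - l))%R).
  - intros n; split.
    + pose proof (Cmod_triangle (u n) (- (u n - l))) as T.
      rewrite Cmod_opp in T.
      replace (u n + - (u n - l)) with l in T by ring; lra.
    + pose proof (Cmod_triangle l (u n - l)) as T.
      replace (l + (u n - l)) with (u n) in T by ring; lra.
  - replace (Finite (Cmod l)) with (Finite (Cmod l - 0)) by (f_equal; ring).
    apply is_lim_seq_minus'; [apply is_lim_seq_const | exact H].
  - replace (Finite (Cmod l)) with (Finite (Cmod l + 0)) by (f_equal; ring).
    apply is_lim_seq_plus'; [apply is_lim_seq_const | exact H].
Qed.

Lemma Ccvg_const (c : C) : Ccvg (fun _ => c) c.
Proof.
  apply Ccvg_squeeze with (fun _ => 0%R); [|apply is_lim_seq_const].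
  intros n; replace (c - c) with (RtoC 0) by ring; rewrite Cmod_0; lra.
Qed.

Lemma Ccvg_mult (u v : nat -> C) (l m : C) :
  Ccvg u l -> Ccvg v m -> Ccvg (fun n => u n * v n) (l * m).
Proof.
  intros Hu Hv; apply Ccvg_squeeze with
    (fun n => (Cmod (u n - l) * Cmod (v n) + Cmod l * Cmod (v n - m))%R).
  - intros n; rewrite <- !Cmod_mult.
    eapply Rle_trans; [|apply Cmod_triangle].
    right; f_equal; ring.
  - replace (Finite 0) with (Finite (0 * Cmod m + Cmod l * 0)) by (f_equal; ring).
    apply is_lim_seq_plus'; apply is_lim_seq_mult'; auto using is_lim_seq_const.
    now apply Ccvg_Cmod.
Qed.

Lemma Ccvg_inv (u : nat -> C) (l : C) :
  (forall n, u n <> 0) -> l <> 0 -> Ccvg u l -> Ccvg (fun n => / u n) (/ l).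
Proof.
  intros Hu Hl H; apply Ccvg_squeeze with
    (fun n => (Cmod (u n - l) * (/ Cmod (u n) * / Cmod l))%R).
  - intros n.
    replace (/ u n - / l) with (- ((u n - l) * (/ u n * / l)))
      by (field; auto).
    rewrite Cmod_opp, !Cmod_mult, !Cmod_inv by auto; lra.
  - assert (Hl' : Cmod l <> 0%R) by (intros E; now apply Hl, Cmod_eq_0).
    replace (Finite 0) with (Finite (0 * (/ Cmod l * / Cmod l))) by (f_equal; ring).
    apply is_lim_seq_mult'; [exact H|].
    apply is_lim_seq_mult'; [|apply is_lim_seq_const].
    apply (is_lim_seq_inv (fun n => Cmod (u n)) (Cmod l)).
    + now apply Ccvg_Cmod.
    + intros E; now injection E.
Qed.

Lemma Ccvg_subseq (u : nat -> C) (l : C) (phi : nat -> nat) :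
  (forall n, (n <= phi n)%nat) -> Ccvg u l -> Ccvg (fun n => u (phi n)) l.
Proof.
  intros Hphi H; apply (is_lim_seq_subseq (fun n => Cmod (u n - l)) 0%R phi).
  - intros P [N HN]; exists N; intros n Hn; apply HN.
    now apply Nat.le_trans with n.
  - exact H.
Qed.

(** Truncated subtraction affects only the indices [n < k], which a shift by [k] discards. *)
Lemma Ccvg_sub_l (u : nat -> C) (l : C) (k : nat) :
  Ccvg u l -> Ccvg (fun n => u (n - k)%nat) l.
Proof.
  intros H; apply (is_lim_seq_incr_n (fun n => Cmod (u (n - k)%nat - l)) k).
  apply is_lim_seq_ext with (fun n => Cmod (u n - l)); [|exact H].
  intros n; now replace (n + k - k)%nat with n by lia.
Qed.

Lemma ex_series_geom_scal (K r : R) :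
  (0 <= r < 1)%R -> ex_series (fun n => K * r ^ n)%R.
Proof.
  intros Hr; apply (ex_series_scal_l (V := R_NormedModule) K).
  apply ex_series_geom; rewrite Rabs_pos_eq; lra.
Qed.

(** The increments [- (x;p)_n x p^n] are dominated by a geometric series, because the symbols are
    bounded. *)
Lemma qpoch_Ccvg (x p : C) :
  (Cmod p < 1)%R -> Ccvg (qpoch x p) (qpoch_inf x p).
Proof.
  intros Hp; destruct (qpoch_bounded x p Hp) as [K HK].
  assert (H : ex_series (V := C_NormedModule)
                (fun n => qpoch x p (S n) - qpoch x p n)).
  { apply (ex_series_le (V := C_CompleteNormedModule)) with
      (b := fun n => ((K * Cmod x) * Cmod p ^ n)%R).
    - intros n; change (Cmod (qpoch x p (S n) - qpoch x p n)
        <= (K * Cmod x) * Cmod p ^ n)%R.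
      replace (qpoch x p (S n) - qpoch x p n) with (- (qpoch x p n * x * p ^ n))
        by (rewrite qpoch_S; ring).
      rewrite Cmod_opp, !Cmod_mult, Cmod_pow.
      apply Rmult_le_compat_r; [apply pow_le, Cmod_ge_0|].
      apply Rmult_le_compat_r; [apply Cmod_ge_0 | apply HK].
    - apply ex_series_geom_scal; split; [apply Cmod_ge_0 | exact Hp]. }
  destruct H as [l Hl]; apply Ccvg_filterlim in Hl.
  assert (H : Ccvg (qpoch x p) (1 + l)).
  (* The increments telescope to [(x;p)_(n+1) - 1], whence the shift by one and the limit
     [1 + l]. *)
  { apply is_lim_seq_incr_1.
    apply is_lim_seq_ext with (2 := Hl); intros n.
    assert (E : qpoch x p (S n) - 1
                = Csum (fun n => qpoch x p (S n) - qpoch x p n) n).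
    { induction n as [|n IH].
      - rewrite Csum_0; simpl; ring.
      - rewrite Csum_S, <- IH; ring. }
    replace (qpoch x p (S n) - (1 + l)) with (qpoch x p (S n) - 1 - l) by ring.
    now rewrite E. }
  unfold qpoch_inf; now rewrite (Ccvg_CLim _ _ H).
Qed.

(** Nonzero factors alone do not prevent a zero limit; the uniform lower bound on the partial
    products does. *)
Lemma qpoch_inf_neq0 (x p : C) :
  (Cmod x < 1)%R -> (Cmod p < 1)%R -> qpoch_inf x p <> 0.
Proof.
  intros Hx Hp E; destruct (qpoch_bounded_below x p Hx Hp) as [d [Hd H]].
  pose proof (Ccvg_Cmod _ _ (qpoch_Ccvg x p Hp)) as L.
  rewrite E, Cmod_0 in L.
  apply (Rlt_not_le _ _ Hd).
  change (Rbar_le d 0%R).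
  exact (is_lim_seq_le (fun _ => d) _ d 0%R H (is_lim_seq_const d) L).
Qed.

(** * Tannery's theorem and geometric domination *)

Lemma tannery (f : nat -> nat -> C) (g : nat -> C) (M : nat -> R) (l : C) :
  (forall k, Ccvg (fun N => f N k) (g k)) ->
  (forall N k, (k <= N)%nat -> (Cmod (f N k) <= M k)%R) ->
  ex_series M -> is_series (V := C_NormedModule) g l ->
  Ccvg (fun N => Csum (f N) N) l.
Proof.
  intros Hf HM [s HS] Hg.
  assert (HgM : forall k, (Cmod (g k) <= M k)%R).
  { intros k; change (Rbar_le (Cmod (g k)) (M k)).
    apply is_lim_seq_le_loc with (u := fun N => Cmod (f N k)) (v := fun _ => M k).
    - exists k; intros N HN; now apply HM.
    - now apply Ccvg_Cmod.
    - apply is_lim_seq_const. }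
  set (d := fun N n => Cmod (Csum (f N) n - Csum g n)).
  assert (Hstep : forall N n,
    (d N (S n) <= d N n + Cmod (f N (S n) - g (S n)))%R).
  { intros N n; unfold d; rewrite !Csum_S.
    eapply Rle_trans; [|apply Cmod_triangle].
    right; f_equal; ring. }
  assert (Hfix : forall K, is_lim_seq (fun N => d N K) 0%R).
  { intros K; induction K as [|K IH].
    - unfold d; apply is_lim_seq_ext with (2 := Hf O).
      intros N; now rewrite !Csum_0.
    - apply is_lim_seq_le_le with (u := fun _ => 0%R)
        (w := fun N => (d N K + Cmod (f N (S K) - g (S K)))%R).
      + intros N; split; [apply Cmod_ge_0 | apply Hstep].
      + apply is_lim_seq_const.
      + replace (Finite 0) with (Finite (0 + 0)) by (f_equal; ring).
        apply is_lim_seq_plus'; [exact IH | apply Hf]. }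
  assert (Hd : is_lim_seq (fun N => d N N) 0%R).
  { apply is_lim_seq_spec; intros eps.
    (* Partial sums of [M] within [eps/8] of [s] differ by less than [eps/4]. Doubled, and added to
       [d N K < eps/8], this stays below [eps]. *)
    assert (He : (0 < eps / 8)%R) by (destruct eps; simpl; lra).
    assert (HS' : is_lim_seq (sum_n M) s) by exact HS.
    apply is_lim_seq_spec in HS'; destruct (HS' (mkposreal _ He)) as [K HK].
    simpl in HK.
    pose proof (Hfix K) as HfK; apply is_lim_seq_spec in HfK.
    destruct (HfK (mkposreal _ He)) as [N0 HN0]; simpl in HN0.
    exists (Nat.max K N0); intros N HN.
    (* Each index past [K] costs at most twice its [M], once for [f N] and once for [g]; [n <= N]
       makes the domination of [f N] available. *)
    assert (Htail : forall n, (K <= n <= N)%nat ->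
      (d N n <= d N K + 2 * (sum_n M n - sum_n M K))%R).
    { intros n; induction n as [|n IH]; intros Hn.
      - replace K with O by lia; lra.
      - destruct (Nat.eq_dec K (S n)) as [->|HKn]; [lra|].
        eapply Rle_trans; [apply Hstep|].
        rewrite sum_Sn; change plus with Rplus.
        assert (IH' := IH ltac:(lia)).
        pose proof (Cmod_triangle (f N (S n)) (- g (S n))) as T.
        rewrite Cmod_opp in T.
        change (f N (S n) + - g (S n))
          with (f N (S n) - g (S n)) in T.
        pose proof (HM N (S n) ltac:(lia)).
        pose proof (HgM (S n)).
        lra. }
    specialize (Htail N ltac:(lia)).
    pose proof (HK K (le_n K)) as A1; pose proof (HK N ltac:(lia)) as A2.
    pose proof (HN0 N ltac:(lia)) as A3.
    apply Rabs_def2 in A1; apply Rabs_def2 in A2; apply Rabs_def2 in A3.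
    rewrite Rminus_0_r, Rabs_pos_eq by apply Cmod_ge_0.
    lra. }
  assert (Hg' : Ccvg (Csum g) l) by (apply Ccvg_filterlim; exact Hg).
  apply Ccvg_squeeze with (fun N => (d N N + Cmod (Csum g N - l))%R).
  - intros N; eapply Rle_trans; [|apply Cmod_triangle].
    right; f_equal; ring.
  - replace (Finite 0) with (Finite (0 + 0)) by (f_equal; ring).
    now apply is_lim_seq_plus'.
Qed.

Definition Cbounded (u : nat -> C) : Prop :=
  exists K, forall n, (Cmod (u n) <= K)%R.

Lemma Cbounded_mult (u v : nat -> C) :
  Cbounded u -> Cbounded v -> Cbounded (fun n => u n * v n).
Proof.
  intros [K HK] [L HL]; exists (K * L)%R; intros n.
  rewrite Cmod_mult; apply Rmult_le_compat; auto using Cmod_ge_0.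
Qed.

Lemma Cbounded_inv_qpoch (x p : C) :
  (Cmod x < 1)%R -> (Cmod p < 1)%R -> Cbounded (fun n => / qpoch x p n).
Proof.
  intros Hx Hp; destruct (qpoch_bounded_below x p Hx Hp) as [d [Hd H]].
  exists (/ d)%R; intros n.
  rewrite Cmod_inv by now apply qpoch_neq0.
  now apply Rinv_le_contravar.
Qed.

Lemma Cbounded_pow (x : C) : (Cmod x <= 1)%R -> Cbounded (fun n => x ^ n).
Proof.
  intros Hx; exists 1%R; intros n; rewrite Cmod_pow, <- (pow1 n).
  apply pow_incr; split; [apply Cmod_ge_0 | exact Hx].
Qed.

Lemma ex_series_bounded_geom (u : nat -> C) (z : C) :
  Cbounded u -> (Cmod z < 1)%R ->
  ex_series (V := C_NormedModule) (fun n => u n * z ^ n).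
Proof.
  intros [K HK] Hz.
  apply (ex_series_le (V := C_CompleteNormedModule)) with
    (b := fun n => (K * Cmod z ^ n)%R).
  - intros n; change (Cmod (u n * z ^ n) <= K * Cmod z ^ n)%R.
    rewrite Cmod_mult, Cmod_pow.
    apply Rmult_le_compat_r; [apply pow_le, Cmod_ge_0 | apply HK].
  - apply ex_series_geom_scal; split; [apply Cmod_ge_0 | exact Hz].
Qed.

(** The form used on both sides of the terminating identity: the weights have a limit independent of
    [k], which factors out of the series. *)
Lemma tannery_geom (g u : nat -> C) (w : nat -> nat -> C) (z w_lim l : C) :
  Cbounded u -> (Cmod z < 1)%R -> (forall k, g k = u k * z ^ k) ->
  (forall k, Ccvg (fun N => w N k) w_lim) ->
  (exists K, forall N k, (Cmod (w N k) <= K)%R) ->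
  is_series (V := C_NormedModule) g l ->
  Ccvg (fun N => Csum (fun k => w N k * g k) N) (w_lim * l).
Proof.
  intros [K HK] Hz Hg Hw [L HL] Hl.
  apply tannery with (g := fun k => w_lim * g k)
    (M := fun k => (L * K * Cmod z ^ k)%R).
  - intros k; apply Ccvg_mult; [apply Hw | apply Ccvg_const].
  - intros N k _; rewrite Hg, !Cmod_mult, Cmod_pow, <- Rmult_assoc.
    apply Rmult_le_compat_r; [apply pow_le, Cmod_ge_0|].
    apply Rmult_le_compat; auto using Cmod_ge_0.
  - apply ex_series_geom_scal; split; [apply Cmod_ge_0 | exact Hz].
  - exact (is_series_scal (V := C_NormedModule) w_lim _ l Hl).
Qed.

(** * The terminating identity and its limit *)

Lemma terminating_identity (q a b : C) (N : nat) :
  a <> 0 -> b <> 0 -> (Cmod q < 1)%R ->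
  (Cmod (a * q ^ 2) < 1)%R -> (Cmod (b * q ^ 2) < 1)%R ->
  Csum (fun j => qpoch (a * b) (q ^ 2) (N - j) / qpoch (q ^ 2) (q ^ 2) (N - j)
     * phi32_term (q ^ 2 / a) (q ^ 2 / b) q (- q ^ 2) (q ^ 3) (q ^ 2)
         (- (a * b)) j) N
  = (1 - q) * (qpoch (a * q ^ 2) (q ^ 2) N * qpoch (b * q ^ 2) (q ^ 2) N)
    * Csum (fun r => / qpoch (q ^ 2) (q ^ 2) (N - r)
                     * / qpoch (q ^ 2) (q ^ 2) (N + r + 1)
                     * double_sum_term q a b r) N.
Proof.
  intros ha hb Hq Hap Hbp.
  assert (Hp : (Cmod (q ^ 2) < 1)%R) by now apply Cmod_pow_lt_1.
  assert (Hq3 : (Cmod (q ^ 3) < 1)%R) by now apply Cmod_pow_lt_1.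
  assert (Np : forall n, qpoch (q ^ 2) (q ^ 2) n <> 0)
    by now intros; apply qpoch_neq0.
  assert (Np2 : forall n, qpoch ((q ^ 2) ^ 2) ((q ^ 2) ^ 2) n <> 0)
    by now intros; apply qpoch_neq0; apply Cmod_pow_lt_1.
  assert (Nodd : forall n, 1 - q ^ (2 * n + 1) <> 0).
  { intros n; apply Cone_minus_neq0; rewrite Nat.add_1_r.
    now apply Cmod_pow_lt_1. }
  assert (Nq : 1 - q <> 0) by now apply Cone_minus_neq0.
  assert (Nq2 : 1 - q ^ 2 <> 0) by now apply Cone_minus_neq0.
  assert (E1 : q ^ 2 / a * (a * b) = b * q ^ 2) by (field; auto).
  assert (E2 : q ^ 2 / b * (a * b) = a * q ^ 2) by (field; auto).
  assert (Ec : q ^ 2 / a * (q ^ 2 / b) * (a * b) = q ^ 2 * q ^ 2)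
    by (field; auto).
  (* The pair is relative to [p], so its denominators carry [(p^2;p)_(n+r)]. Passing to
     [(p;p)_(n+r+1)] explains the factor [1 / (1 - q^2)] in [alpha]. *)
  assert (Hc : forall n, qpoch (q ^ 2) (q ^ 2) (n + 1)
                         = (1 - q ^ 2) * qpoch (q ^ 2 * q ^ 2) (q ^ 2) n)
    by (intros n; rewrite qpoch_shift, Nat.add_1_r; apply qpoch_S).
  assert (Nc : forall n, qpoch (q ^ 2 * q ^ 2) (q ^ 2) n <> 0).
  { intros n H; apply (Np (n + 1)%nat); rewrite Hc, H; ring. }
  assert (Na : forall n, qpoch (a * q ^ 2) (q ^ 2) n <> 0)
    by now intros; apply qpoch_neq0.
  assert (Nb : forall n, qpoch (b * q ^ 2) (q ^ 2) n <> 0)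
    by now intros; apply qpoch_neq0.
  pose (beta := fun n => (1 - q) / (1 - q ^ (2 * n + 1))
                 * ((-1) ^ n / qpoch ((q ^ 2) ^ 2) ((q ^ 2) ^ 2) n)).
  pose (alpha := fun r => (1 - q) / (1 - q ^ 2)
                 * ((-1) ^ r * (1 + q ^ (2 * r + 1)) * theta q r)).
  pose proof (finite_bailey_lemma alpha beta (q ^ 2 / a) (q ^ 2 / b) (a * b)
    (q ^ 2) N) as HB.
  rewrite E1, E2, Ec in HB.
  specialize (HB Np Nc Nb Na).
  match type of HB with ?H -> _ => assert (Hpair : H) end.
  { intros n; unfold beta; rewrite <- theta_bailey_pair by assumption.
    rewrite Cmult_assoc.
    replace ((1 - q) / (1 - q ^ (2 * n + 1)) * (1 - q ^ (2 * n + 1)))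
      with (1 - q) by (field; auto).
    rewrite <- Csum_scal; apply Csum_ext; intros r _.
    unfold alpha; rewrite Hc; field; auto. }
  specialize (HB Hpair).
  transitivity (Csum (fun j => qpoch (q ^ 2 / a) (q ^ 2) j
    * qpoch (q ^ 2 / b) (q ^ 2) j * (a * b) ^ j * beta j
    * (qpoch (a * b) (q ^ 2) (N - j) / qpoch (q ^ 2) (q ^ 2) (N - j))) N).
  - apply Csum_ext; intros j _; unfold phi32_term, beta.
    rewrite <- (qpoch_opp (q ^ 2) j).
    replace (- (a * b)) with (-1 * (a * b)) by ring.
    rewrite Cpow_mult_l.
    rewrite Cpow_odd.
    assert (Nm : qpoch (- q ^ 2) (q ^ 2) j <> 0)
      by (apply qpoch_neq0; [rewrite Cmod_opp|]; assumption).
    assert (N3 : qpoch (q ^ 3) (q ^ 2) j <> 0) by now apply qpoch_neq0.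
    assert (N1 : 1 - q * (q ^ 2) ^ j <> 0).
    { rewrite <- Cpow_odd; apply Nodd. }
    (* The quotient [(q;q^2)_j / (q^3;q^2)_j] collapses to [(1 - q) / (1 - q^(2j+1))], the first
       factor of [beta]; the sign in [beta] goes into the argument [- (a * b)]. *)
    assert (E3 : qpoch q (q ^ 2) j
                 = (1 - q) * qpoch (q ^ 3) (q ^ 2) j / (1 - q * (q ^ 2) ^ j)).
    { replace (q ^ 3) with (q * q ^ 2) by ring.
      rewrite qpoch_shift; field; exact N1. }
    rewrite E3.
    revert N1; generalize ((q ^ 2) ^ j) ((-1) ^ j) ((a * b) ^ j).
    intros; field; cbv beta; repeat split; auto.
  - rewrite HB.
    rewrite (Cmult_comm (1 - q)), <- (Cmult_assoc _ (1 - q)).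
    rewrite <- (Csum_scal (1 - q)), (Cmult_comm (qpoch (b * q ^ 2) _ N)).
    f_equal; apply Csum_ext; intros r _.
    rewrite double_sum_term_theta, Hc; unfold alpha.
    generalize ((-1) ^ r) ((a * b) ^ r) (q ^ (2 * r + 1)).
    intros; field; repeat split; auto.
Qed.

Theorem theorem3p2 (q a b : C)
    (hq0 : q <> 0) (ha0 : a <> 0) (hb0 : b <> 0)
    (hq : (Cmod q < 1)%R)
    (hmax : (Rmax (Rmax (Cmod (a * b)) (Cmod (a * q ^ 2))) (Cmod (b * q ^ 2))
             < 1)%R) :
  ex_series (phi32_term (q ^ 2 / a) (q ^ 2 / b) q (- q ^ 2) (q ^ 3)
               (q ^ 2) (- (a * b))) /\
  ex_series (double_sum_term q a b) /\
  (qpoch_inf (q ^ 2) (q ^ 2) * qpoch_inf (a * b) (q ^ 2))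
    / (qpoch_inf (a * q ^ 2) (q ^ 2) * qpoch_inf (b * q ^ 2) (q ^ 2))
    * phi32 (q ^ 2 / a) (q ^ 2 / b) q (- q ^ 2) (q ^ 3) (q ^ 2) (- (a * b))
  = (1 - q) * CSeries (double_sum_term q a b).
Proof.
  assert (Hab : (Cmod (a * b) < 1)%R).
  { apply Rle_lt_trans with (2 := hmax).
    eapply Rle_trans; [apply Rmax_l | apply Rmax_l]. }
  assert (Ha : (Cmod (a * q ^ 2) < 1)%R).
  { apply Rle_lt_trans with (2 := hmax).
    eapply Rle_trans; [apply Rmax_r | apply Rmax_l]. }
  assert (Hb : (Cmod (b * q ^ 2) < 1)%R).
  { apply Rle_lt_trans with (2 := hmax); apply Rmax_r. }
  assert (Hp : (Cmod (q ^ 2) < 1)%R) by now apply Cmod_pow_lt_1.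
  assert (Hq3 : (Cmod (q ^ 3) < 1)%R) by now apply Cmod_pow_lt_1.
  assert (Hz : (Cmod (- (a * b)) < 1)%R) by now rewrite Cmod_opp.
  assert (Bq : forall x, Cbounded (qpoch x (q ^ 2)))
    by now intros x; apply qpoch_bounded.
  set (X := phi32_term (q ^ 2 / a) (q ^ 2 / b) q (- q ^ 2) (q ^ 3)
               (q ^ 2) (- (a * b))).
  set (Y := double_sum_term q a b).
  (* [x], and [y] below, are the coefficients without the geometric power; separate inverses let
     boundedness be proved factor by factor. *)
  set (x := fun n => (qpoch (q ^ 2 / a) (q ^ 2) n * qpoch (q ^ 2 / b) (q ^ 2) n
                      * qpoch q (q ^ 2) n)
      * (/ qpoch (q ^ 2) (q ^ 2) n * / qpoch (- q ^ 2) (q ^ 2) n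
         * / qpoch (q ^ 3) (q ^ 2) n)).
  assert (Bx : Cbounded x).
  { repeat apply Cbounded_mult; auto; apply Cbounded_inv_qpoch; auto.
    now rewrite Cmod_opp. }
  assert (EX : forall n, X n = x n * (- (a * b)) ^ n).
  { intros n; unfold X, x, phi32_term; field; repeat split;
      apply qpoch_neq0; auto; now rewrite Cmod_opp. }
  set (y := fun n => (-1) ^ n * (1 + q ^ (2 * n + 1))
    * (qpoch (q ^ 2 / a) (q ^ 2) n * qpoch (q ^ 2 / b) (q ^ 2) n
       * (/ qpoch (a * q ^ 2) (q ^ 2) n * / qpoch (b * q ^ 2) (q ^ 2) n))
    * theta q n).
  assert (By : Cbounded y).
  { repeat apply Cbounded_mult; auto using Cbounded_inv_qpoch.
    - apply Cbounded_pow; rewrite Cmod_R, Rabs_left; lra.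
    - exists 2%R; intros n; eapply Rle_trans; [apply Cmod_triangle|].
      rewrite Cmod_1, Nat.add_1_r; pose proof (Cmod_pow_lt_1 q (2 * n) hq); lra.
    - exists (2 / (1 - Cmod q))%R; intros n; now apply theta_bound. }
  assert (EY : forall n, Y n = y n * (a * b) ^ n).
  { intros n; unfold Y, y; rewrite double_sum_term_theta.
    generalize ((-1) ^ n) (q ^ (2 * n + 1)) ((a * b) ^ n).
    intros; field; split; now apply qpoch_neq0. }
  destruct (ex_series_bounded_geom x _ Bx Hz) as [sX HsX].
  destruct (ex_series_bounded_geom y _ By Hab) as [sY HsY].
  assert (HX : is_series (V := C_NormedModule) X sX)
    by (apply is_series_ext with (2 := HsX); intros n; symmetry; apply EX).
  assert (HY : is_series (V := C_NormedModule) Y sY)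
    by (apply is_series_ext with (2 := HsY); intros n; symmetry; apply EY).
  split; [exists sX; exact HX|].
  split; [exists sY; exact HY|].
  unfold phi32; fold X.
  rewrite (is_series_CSeries _ _ HX), (is_series_CSeries _ _ HY).
  set (P := qpoch_inf (q ^ 2) (q ^ 2)).
  assert (NP : P <> 0) by now apply qpoch_inf_neq0.
  assert (CP : Ccvg (fun n => / qpoch (q ^ 2) (q ^ 2) n) (/ P)).
  { apply Ccvg_inv; auto using qpoch_Ccvg; now intros; apply qpoch_neq0. }
  assert (BP : Cbounded (fun n => / qpoch (q ^ 2) (q ^ 2) n))
    by now apply Cbounded_inv_qpoch.
  assert (L : Ccvg (fun N => Csum (fun j =>
      qpoch (a * b) (q ^ 2) (N - j) / qpoch (q ^ 2) (q ^ 2) (N - j) * X j) N)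
      (qpoch_inf (a * b) (q ^ 2) * / P * sX)).
  { apply tannery_geom with (1 := Bx) (2 := Hz) (3 := EX) (6 := HX).
    - intros k.
      apply (Ccvg_sub_l (fun n => qpoch (a * b) (q ^ 2) n * / qpoch (q ^ 2) (q ^ 2) n)).
      now apply Ccvg_mult; [apply qpoch_Ccvg|].
    - destruct (Cbounded_mult _ _ (Bq (a * b)) BP) as [K HK].
      exists K; intros N k; apply HK. }
  assert (L' : Ccvg (fun N => Csum (fun r =>
      / qpoch (q ^ 2) (q ^ 2) (N - r) * / qpoch (q ^ 2) (q ^ 2) (N + r + 1)
      * Y r) N) (/ P * / P * sY)).
  { apply tannery_geom with (1 := By) (2 := Hab) (3 := EY) (6 := HY).
    - intros k; apply Ccvg_mult.
      + exact (Ccvg_sub_l _ _ k CP).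
      + apply (Ccvg_subseq (fun n => / qpoch (q ^ 2) (q ^ 2) n)
                 _ (fun n => n + k + 1)%nat); [intros n; lia | exact CP].
    - destruct BP as [K HK]; exists (K * K)%R; intros N k.
      rewrite Cmod_mult; apply Rmult_le_compat; auto using Cmod_ge_0. }
  (* By the terminating identity, both sides are limits of one sequence. *)
  assert (E : qpoch_inf (a * b) (q ^ 2) * / P * sX
    = (1 - q) * (qpoch_inf (a * q ^ 2) (q ^ 2) * qpoch_inf (b * q ^ 2) (q ^ 2))
      * (/ P * / P * sY)).
  { apply Ccvg_unique with (1 := L).
    eapply is_lim_seq_ext.
    - intros N; unfold X; now rewrite terminating_identity.
    - apply Ccvg_mult; [|exact L'].
      apply Ccvg_mult; [apply Ccvg_const|].
      now apply Ccvg_mult; apply qpoch_Ccvg. }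
  assert (NA : qpoch_inf (a * q ^ 2) (q ^ 2) <> 0) by now apply qpoch_inf_neq0.
  assert (NB : qpoch_inf (b * q ^ 2) (q ^ 2) <> 0) by now apply qpoch_inf_neq0.
  revert NA NB E.
  generalize (qpoch_inf (a * q ^ 2) (q ^ 2)) (qpoch_inf (b * q ^ 2) (q ^ 2))
    (qpoch_inf (a * b) (q ^ 2)).
  intros A B D NA NB E.
  (* Scaling [E] by [P^2 / (A B)] clears both factors [/ P] on its right and leaves a single [P] on
     its left. *)
  transitivity (P * P / (A * B) * (D * / P * sX)); [field; auto|].
  rewrite E; field; auto.
Qed.
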